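(* There is an absolute constant $C>0$ such that for every shape $\tau$ and every integer $t\ge1$, with $\mathbf M_\tau$ the graph matrix of $\tau$ for the dense random graph, $$\mathbb E\big\|\mathbf M_\tau-\mathbb E\mathbf M_\tau\big\|_{2t}^{2t}\le\Big(C^{t|E(\tau)|}\,n^{|V(\tau)|}\,t^{t|E(\tau)|}\,|E(\tau)|^{2t|E(\tau)|}\Big)\,n^{t(|V(\tau)|-|S_\tau|+|I_\tau|)}.$$
   Context: Dense random graph: for each unordered pair $\{i,j\}$ of distinct elements of $[n]$ there is a variable $G_{i,j}=G_{j,i}$, and these are independent and uniform on $\{-1,1\}$. A shape $\tau=(V(\tau),E(\tau),U_\tau,V_\tau)$ is a finite graph $(V(\tau),E(\tau))$ together with two ordered subsets $U_\tau,V_\tau\subseteq V(\tau)$ (not necessarily disjoint). A realization of $\tau$ is an injective map $\varphi:V(\tau)\to[n]$. Let $\mathcal I$ be the set of tuples of distinct elements of $[n]$ (including the empty tuple). The graph matrix $\mathbf M_\tau\in\mathbb R^{\mathcal I\times\mathcal I}$ has entries $\mathbf M_\tau[I,J]=\sum_{\varphi}\prod_{\{u,v\}\in E(\tau)}G_{\varphi(u),\varphi(v)}$, the sum over realizations $\varphi$ with $\varphi(U_\tau)=I$ and $\varphi(V_\tau)=J$ as ordered tuples. A vertex separator of $\tau$ is a set $S\subseteq V(\tau)$ such that, after deleting $S$ and all incident edges, there is no path from a vertex of $U_\tau$ to a vertex of $V_\tau$ (so $U_\tau\cap V_\tau\subseteq S$); $S_\tau$ is a vertex separator of minimum size. $I_\tau$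 is the set of degree-$0$ vertices of $\tau$ in $V(\tau)\setminus(U_\tau\cup V_\tau)$. For a real matrix $\mathbf M$, $\|\mathbf M\|_{2t}^{2t}=\operatorname{tr}((\mathbf M\mathbf M^\intercal)^t)$. *)

(* Defs.v *)
From HB Require Import structures.
From mathcomp Require Import all_boot all_order all_algebra.
From mathcomp Require Import reals.
Set Implicit Arguments. Unset Strict Implicit. Unset Printing Implicit Defensive.
Import Order.TTheory GRing.Theory Num.Theory.
Local Open Scope ring_scope.

Record gshape := GShape {
  nv : nat;
  edges : {set {set 'I_nv}};
  edges2 : forall e, e \in edges -> #|e| == 2%N;
  Us : seq 'I_nv;
  Vs : seq 'I_nv;
  Us_uniq : uniq Us;
  Vs_uniq : uniq Vs }.

Definition upair (n : nat) := {e : {set 'I_n} | #|e| == 2%N}.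

Definition sample (n : nat) := {ffun upair n -> bool}.

Definition sgn (R : pzRingType) (b : bool) : R := if b then 1 else -1.

(* G_{e} for a 2-subset e of [n] (value 1 on non-pairs; never used). *)
Definition Gval (R : pzRingType) n (G : sample n) (e : {set 'I_n}) : R :=
  match insub e with Some p => sgn R (G p) | None => 1 end.

Definition Exp (R : realType) n (f : sample n -> R) : R :=
  (#|{: sample n}|%:R)^-1 * \sum_(G : sample n) f G.

Definition dtuple (n : nat) :=
  {x : {k : 'I_n.+1 & k.-tuple 'I_n} | uniq (tagged x)}.
Definition seqof n (I : dtuple n) : seq 'I_n := tagged (val I).

Definition graph_mx_entry (R : pzRingType) n (tau : gshape) (G : sample n)
  (I J : dtuple n) : R :=
  \sum_(phi : {ffun 'I_(nv tau) -> 'I_n} |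
          [&& injectiveb phi, map phi (Us tau) == seqof I
            & map phi (Vs tau) == seqof J])
     \prod_(e in edges tau) Gval R G (phi @: e).

Definition mx_of (R : pzRingType) (T : finType) (f : T -> T -> R) : 'M[R]_#|T| :=
  \matrix_(i, j) f (enum_val i) (enum_val j).

(* ||M||_{2t}^{2t} = tr ((M M^T)^t). *)
Definition schatten_pow (R : pzRingType) m (A : 'M[R]_m) (t : nat) : R :=
  \tr (iter t (mulmx (A *m A^T)) 1%:M).

Definition avoid_rel (tau : gshape) (S : {set 'I_(nv tau)}) : rel 'I_(nv tau) :=
  fun x y => [&& x \notin S, y \notin S & [set x; y] \in edges tau].

Definition is_separator (tau : gshape) (S : {set 'I_(nv tau)}) : bool :=
  [forall u, forall w,
     [&& u \in Us tau, w \in Vs tau, u \notin S & w \notin S]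
       ==> ~~ connect (avoid_rel S) u w].

(* |S_tau| : minimum size of a vertex separator (the full vertex set is one). *)
Definition min_sep_size (tau : gshape) : nat :=
  \big[minn/nv tau]_(S : {set 'I_(nv tau)} | is_separator S) #|S|.

Definition num_isolated (tau : gshape) : nat :=
  #|[set x : 'I_(nv tau) | [&& x \notin Us tau, x \notin Vs tau
        & [forall e in edges tau, x \notin e]]]|.

(* Main.v *)
Require Import Defs.
From HB Require Import structures.
From mathcomp Require Import all_boot all_order all_algebra.
From mathcomp Require Import reals zify lra.
Import Order.TTheory GRing.Theory Num.Theory.
Set Implicit Arguments. Unset Strict Implicit. Unset Printing Implicit Defensive.

(** Expanding the trace, the left-hand side counts the closed walks of [2t]
    realizations, glued alternately along [V_tau] and [U_tau], in which every pair
    of [[n]] is used an even number of times.  Match the [2tE] edge occurrences into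
    oriented pairs with equal labels: there are at most [(4tE)^(tE)] matchings.
    A matching and the gluing generate an equivalence on (block, vertex) pairs, and
    a walk compatible with them is constant on classes, so there are at most
    [n^c] of these, [c] being the number of classes.
    To bound [c], count every class once at its first and once at its last block.
    In a given block let [A] (resp. [B]) be the vertices whose class occurs in an
    earlier (resp. later) block.  Edges are matched across blocks, so each lies in
    [A] or in [B], and [A :|: B] misses only isolated vertices; in a block that is
    neither first nor last the two boundaries lie one in [A] and the other in [B],
    so [A :&: B] is a separator.  Hence [2c] is at most [nv - s + iso] per block
    plus [2s] for the two extreme blocks. *)

(** * Vertex separators *)

Lemma bigminn_le_cond (I : eqType) (r : seq I) (P : pred I) (F : I -> nat)
  (x0 : nat) (j : I) :
  j \in r -> P j -> \big[minn/x0]_(i <- r | P i) F i <= F j.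
Proof.
elim: r => // a r IH; rewrite inE big_cons => /orP[/eqP <- -> | jr Pj].
  exact: geq_minl.
by case: ifP => _; [apply: leq_trans (geq_minr _ _) (IH jr Pj) | apply: IH].
Qed.

Lemma min_sep_size_le (tau : gshape) (S : {set 'I_(nv tau)}) :
  is_separator S -> min_sep_size tau <= #|S|.
Proof. by move=> HS; apply: bigminn_le_cond => //; rewrite mem_index_enum. Qed.

Lemma min_sep_size_nv (tau : gshape) : min_sep_size tau <= nv tau.
Proof.
rewrite /min_sep_size; elim/big_ind: _ => // [x y Hx _ | S _].
  by apply: leq_trans (geq_minl _ _) Hx.
by rewrite -[leqRHS]card_ord max_card.
Qed.

(** A path that starts in [A] and avoids [A :&: B] never leaves [A]: its current vertex is not in
    [B], so the next edge is not inside [B] and must lie inside [A]. Its end, being in [B] too,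
    would fall in the deleted set. *)
Lemma separator_of_cover (tau : gshape) (A B : {set 'I_(nv tau)}) :
  (forall e, e \in edges tau -> (e \subset A) || (e \subset B)) ->
  {subset Us tau <= A} -> {subset Vs tau <= B} -> is_separator (A :&: B).
Proof.
move=> HE HU HV; apply/forallP => u; apply/forallP => w; apply/implyP.
case/and4P => uU wV uS wS; apply/negP => /connectP[p Hp Ew].
have uA := HU u uU; have wB := HV w wV.
suff wA : w \in A by move: wS; rewrite inE wA wB.
rewrite {}Ew {wV uU wS wB w}; elim: p u uA uS Hp => //= y p IH u uA uS.
case/andP => /and3P[_ yS He] Hp; apply: IH Hp => //.
case/orP: (HE _ He) => /subsetP sub; first by apply: sub; rewrite !inE eqxx orbT.
by move: uS; rewrite inE uA sub // !inE eqxx.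
Qed.

(** * Counting classes by their first and last blocks *)

(* The set [A] above when [r] is the position of a block in the walk, [B] for the reversed order. *)
Definition seen (B V Z : finType) (r : B -> nat) (c : B * V -> Z) (b : B) :
  {set V} := [set v | [exists x : B * V, (r x.1 < r b) && (c x == c (b, v))]].

Lemma seenP (B V Z : finType) (r : B -> nat) (c : B * V -> Z) b b' v w :
  r b' < r b -> c (b, v) = c (b', w) -> v \in seen r c b.
Proof. by move=> rb E; rewrite inE; apply/existsP; exists (b', w); rewrite rb E /=. Qed.

(** A member of least rank in its class is never in [seen], so the unseen pairs already meet every
    class. A class may have several vertices in its first block, hence only an inequality. *)
Lemma card_classes_first (B V Z : finType) (r : B -> nat) (c : B * V -> Z) :
  #|c @: setT| <= \sum_b (#|V| - #|seen r c b|).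
Proof.
pose F := [set x : B * V | x.2 \notin seen r c x.1].
have -> : \sum_b (#|V| - #|seen r c b|) = #|F|.
  rewrite -sum1_card (eq_bigl (fun x : B * V => x.2 \in ~: seen r c x.1)); last first.
    by move=> x; rewrite !inE.
  rewrite -(pair_big_dep xpredT (fun b v => v \in ~: seen r c b) (fun _ _ => 1)) /=.
  by apply: eq_bigr => b _; rewrite sum1_card -(cardsC (seen r c b)) addKn.
suff: c @: setT \subset c @: F by move/subset_leq_card/leq_trans; apply; apply: leq_imset_card.
apply/subsetP => _ /imsetP[x _ ->].
case: (@arg_minnP _ x (fun y => c y == c x) (fun y => r y.1) (eqxx _)) => -[b v] /eqP Ey Hmin.
rewrite -Ey; apply: imset_f; rewrite !inE; apply/existsPn => z.
apply/negP => /andP[lt /eqP Ez]; have := Hmin z; rewrite Ez Ey eqxx => /(_ isT).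
by move: lt => /=; rewrite ltnNge => /negP.
Qed.

(** By inclusion-exclusion the left side is [nv tau] plus the number of vertices outside [A :|: B],
    and those are isolated. *)
Lemma block_weight (tau : gshape) (A B : {set 'I_(nv tau)}) :
  (forall x, [|| x \in Us tau, x \in Vs tau | [exists e in edges tau, x \in e]] ->
     x \in A :|: B) ->
  (nv tau - #|A|) + (nv tau - #|B|) + #|A :&: B| <= nv tau + num_isolated tau.
Proof.
move=> H; have: #|~: (A :|: B)| <= num_isolated tau.
  apply/subset_leq_card/subsetP => x; rewrite in_setC => nx; rewrite inE.
  have := contra (H x) nx; rewrite !negb_or => /and3P[-> -> /=].
  rewrite negb_exists => /forallP Hx; apply/forallP => e; apply/implyP => eE.
  by have := Hx e; rewrite eE.
have := cardsC (A :|: B); have := cardsUI A B.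
have := max_card A; have := max_card B; rewrite !card_ord.
by lia.
Qed.

(** Adds the count by first blocks to the count by last blocks. The last hypothesis gives every
    block other than [i0] and [i1] an earlier and a later neighbour sharing opposite boundaries,
    which yields the separator. *)
Lemma card_classes (tau : gshape) (B Z : finType) (r : B -> nat) (M : nat)
  (c : B * 'I_(nv tau) -> Z) (i0 i1 : B) :
  injective r -> (forall b, r b < M) ->
  (forall b e, e \in edges tau -> exists2 b', b' != b &
     forall x, x \in e -> exists y, c (b, x) = c (b', y)) ->
  (forall b x, (x \in Us tau) || (x \in Vs tau) -> exists2 b', b' != b &
     exists y, c (b, x) = c (b', y)) ->
  (forall b, b != i0 -> b != i1 ->
     exists b1 b2 : B, r b1 < r b < r b2 /\
     ((forall x, x \in Us tau -> c (b, x) = c (b1, x)) /\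
      (forall x, x \in Vs tau -> c (b, x) = c (b2, x)) \/
      (forall x, x \in Us tau -> c (b, x) = c (b2, x)) /\
      (forall x, x \in Vs tau -> c (b, x) = c (b1, x)))) ->
  (#|c @: setT|).*2 <= #|B| * (nv tau - min_sep_size tau + num_isolated tau)
                       + (min_sep_size tau).*2.
Proof.
move=> rI rM He Hb Hm; set s := min_sep_size tau; set K := _ + num_isolated tau.
(* The reversed order; the strict bound [M] keeps the truncated subtraction strictly decreasing in
   [r b]. *)
pose r' b := M - r b.
have ltr b b' : b' != b -> (r b' < r b) || (r' b' < r' b).
  by move=> nb; have := rM b; have := rM b'; have := contra_neq (@rI b' b) nb; rewrite /r'; lia.
pose A := seen r c; pose A' := seen r' c.
have side b e : e \in edges tau -> (e \subset A b) || (e \subset A' b).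
  move=> /(He b)[b' /ltr/orP[lt|lt] Hx]; apply/orP; [left|right]; apply/subsetP => x /Hx[y E];
    exact: seenP lt E.
have W b : (nv tau - #|A b|) + (nv tau - #|A' b|) + #|A b :&: A' b| <= nv tau + num_isolated tau.
  apply: block_weight => x; rewrite orbA => /orP[/(Hb b)[b' /ltr nb [y E]]|].
    by rewrite inE; case/orP: nb => lt; rewrite (seenP lt E) ?orbT.
  case/exists_inP => e /(side b)/orP[]/subsetP sub /sub xA; rewrite inE xA ?orbT //.
have Wm b : b != i0 -> b != i1 -> (nv tau - #|A b|) + (nv tau - #|A' b|) <= K.
  move=> b0 b1; suff: s <= #|A b :&: A' b|.
    by have := W b; have := min_sep_size_nv tau; rewrite /K -/s; lia.
  have [c1 [c2 [/andP[l1 l2] H]]] := Hm b b0 b1.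
  have l2' : r' c2 < r' b by rewrite /r'; have := rM c2; lia.
  apply: min_sep_size_le; case: H => -[HU HV].
    apply: separator_of_cover; first exact: side.
      by move=> x /HU E; apply: seenP l1 E.
    by move=> x /HV E; apply: seenP l2' E.
  (* Here the walk crosses the block from [Vs] to [Us], so the two sets exchange roles. *)
  rewrite setIC; apply: separator_of_cover; first by move=> e /(side b); rewrite orbC.
    by move=> x /HU E; apply: seenP l2' E.
  by move=> x /HV E; apply: seenP l1 E.
have S0 (i : B) : \sum_b (b == i) * s = s.
  by rewrite (bigD1 i) //= eqxx mul1n big1 ?addn0 // => b /negPf ->.
apply: (@leq_trans (\sum_b (K + (b == i0) * s + (b == i1) * s))); last first.
  by rewrite 2!big_split /= !S0 sum_nat_const -addnn addnA.
have := leq_add (card_classes_first r c) (card_classes_first r' c).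
rewrite addnn card_ord -big_split /= => /leq_trans; apply; apply: leq_sum => b _.
(* In an extreme block only [W] is available; it gives [K + s], which the extra summand pays for. *)
have := W b; have := @Wm b; have := min_sep_size_nv tau; rewrite /A /A' /K -/s.
case: (b == i0); case: (b == i1) => /=; rewrite ?mul1n ?mul0n; lia.
Qed.

(** * Functions constant on classes, and perfect matchings of a list *)

(** Such a function is determined by its values at the class representatives [fingraph.root e]. *)
Lemma card_constant_on_classes (P Y : finType) (e : rel P) :
  connect_sym e ->
  #|[set f : {ffun P -> Y} | [forall x, forall y, e x y ==> (f x == f y)]]|
    <= #|Y| ^ #|fingraph.root e @: setT|.
Proof.
move=> se; set X := [set f | _]; set Z := fingraph.root e @: setT.
have fR f x : f \in X -> f x = f (fingraph.root e x).
  rewrite inE => /forallP Hf; case/connectP: (connect_root e x) => p Hp ->.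
  elim: p x Hp => //= y p IH x /andP[xy /IH <-].
  by have /forallP/(_ y) := Hf x; rewrite xy => /eqP.
pose g (f : {ffun P -> Y}) : {ffun {z | z \in Z} -> Y} := [ffun z => f (val z)].
rewrite -(@card_in_imset _ _ g X); last first.
  move=> f1 f2 X1 X2 E; apply/ffunP => x; rewrite fR // [RHS]fR //.
  have xZ : fingraph.root e x \in Z by apply: imset_f.
  by have /ffunP/(_ (exist (fun z => z \in Z) _ xZ)) := E; rewrite !ffunE.
apply: leq_trans (max_card _) _.
by rewrite card_ffun card_sig.
Qed.

(* The entry [(o, o', b)] matches [o] with [o']; the bit [b] leaves room for an orientation. *)
Fixpoint pairings (O : eqType) (k : nat) (L : seq O) : seq (seq (O * O * bool)) :=
  match k, L with
  | k'.+1, o :: L' =>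
      [seq (o, z.1, z.2) :: p | z <- [seq (o', b) | o' <- L', b <- [:: true; false]],
                               p <- pairings k' (rem z.1 L')]
  | _, _ => [:: [::]]
  end.

Lemma pairingsS (O : eqType) (k : nat) (o : O) (L : seq O) :
  pairings k.+1 (o :: L) =
  [seq (o, z.1, z.2) :: p | z <- [seq (o', b) | o' <- L, b <- [:: true; false]],
                           p <- pairings k (rem z.1 L)].
Proof. by []. Qed.

(** Each of the [k] rounds offers at most [N] partners for the head, with two orientations each. *)
Lemma size_pairings (O : eqType) (k N : nat) (L : seq O) :
  size L <= N -> 0 < N -> size (pairings k L) <= (2 * N) ^ k.
Proof.
elim: k L => [|k IH] [|o L] HL HN //; first by rewrite expn_gt0 muln_gt0 HN.
rewrite pairingsS size_allpairs_dep expnS; set zs := [seq (o', b) | o' <- L, b <- [:: true; false]].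
have Hz : size zs <= 2 * N by rewrite size_allpairs /= mulnC leq_mul2l /= ltnW.
apply: (@leq_trans (size zs * (2 * N) ^ k)); last by rewrite leq_mul2r Hz orbT.
have: all (fun z => z.1 \in L) zs.
  by apply/allP => _ /allpairsP[[a b] /= [aL _ ->]].
elim: zs {Hz} => //= z zs IHz /andP[zL /IHz Hs].
rewrite mulSn leq_add // IH // size_rem //.
by apply: leq_trans HL; apply: leq_trans (leq_pred _) (leqnSn _).
Qed.

(** Length [k.*2] makes the [k] rounds exhaust the list. *)
Lemma pairings_cover (O : eqType) (k : nat) (L : seq O) p o :
  size L = k.*2 -> p \in pairings k L -> o \in L ->
  exists2 z, z \in p & o = z.1.1 \/ o = z.1.2.
Proof.
elim: k L p => [|k IH] [|o1 L] p //; rewrite pairingsS doubleS => -[sL].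
case/allpairsPdep => -[o2' b] [p' [/allpairsP[[o2 b'] /= [o2L _ [-> _ {o2' b'}]]] Hp' ->]].
rewrite inE => /orP[/eqP ->|oL].
  by exists (o1, o2, b); [exact: mem_head|left].
have [->|no] := eqVneq o o2; first by exists (o1, o2, b); [exact: mem_head|right].
have [||z zp Hz] := IH _ _ _ Hp'.
- by rewrite size_rem // sL.
- by move: oL; rewrite (perm_mem (perm_to_rem o2L)) inE (negPf no).
by exists z => //; rewrite inE zp orbT.
Qed.

(** Even multiplicity gives the head a partner with the same label in the tail; removing both
    preserves all parities. *)
Lemma pairing_exists (O Lab : eqType) (lab : O -> Lab) (ok : pred (O * O * bool))
  (k : nat) (L : seq O) :
  uniq L -> size L = k.*2 -> (forall x, ~~ odd (count_mem x (map lab L))) ->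
  (forall o o', o \in L -> o' \in L -> o != o' -> lab o = lab o' ->
     exists b, ok (o, o', b)) ->
  exists2 p, p \in pairings k L & all ok p.
Proof.
elim: k L => [|k IH] [|o L] //; first by exists [::].
rewrite doubleS => /andP[oL uL] [sL] ev Hok.
have /mapP[o' o'L Eo] : lab o \in map lab L.
  have := ev (lab o); rewrite /= eqxx add1n /= negbK -has_pred1 has_count.
  by case: count.
have no : o != o' by apply: contraNneq oL => ->.
have [||b Hb] := Hok o o' _ _ no Eo; [exact: mem_head|by rewrite inE o'L orbT|].
have P := perm_to_rem o'L.
have [|||x y xL yL|p Hp ap] := IH (rem o' L).
- exact: rem_uniq.
- by rewrite size_rem // sL.
- move=> x; have := ev x; rewrite /= (permP (perm_map lab P)) /= Eo addnA addnn.
  by rewrite oddD odd_double.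
- by apply: Hok; rewrite inE (mem_rem xL, mem_rem yL) orbT.
exists ((o, o', b) :: p); last by rewrite /= Hb.
rewrite pairingsS; apply/allpairsPdep; exists (o', b), p; split => //.
by apply/allpairsP; exists (o', b); split => //; case: b {Hb}; rewrite !inE.
Qed.

(** * Blocks, gluing and matched edges *)

(* The realization in block [(k, false)] goes from [I_k] to [J_k], the one in [(k, true)]
   from [I_(k+1)] to [J_k]. *)
Notation block t := ('I_t * bool)%type.

Definition brank (t : nat) (b : block t) : nat := b.1.*2 + b.2.

(** The cyclic successor [ordS] closes the walk. The [Us] clause is directed; the relation is
    symmetrized when classes are formed. *)
Definition glued (tau : gshape) (t : nat) (x y : block t * 'I_(nv tau)) : bool :=
  (x.2 == y.2) &&
  (((x.1.1 == y.1.1) && (x.2 \in Vs tau)) ||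
   [&& x.1.2, ~~ y.1.2, y.1.1 == ordS x.1.1 & x.2 \in Us tau]).

Definition occurrences (tau : gshape) (t : nat) :
  seq (block t * {set 'I_(nv tau)}) :=
  [seq (b, e) | b <- enum {: block t}, e <- enum (edges tau)].

Definition label (V : finType) (t n : nat) (F : {ffun block t * V -> 'I_n})
  (o : block t * {set V}) : {set 'I_n} := [set F (o.1, v) | v in o.2].

Definition closed_walk (tau : gshape) (t n : nat)
  (F : {ffun block t * 'I_(nv tau) -> 'I_n}) : bool :=
  [&& [forall b, injectiveb [ffun v => F (b, v)]],
      [forall x, forall y, glued x y ==> (F x == F y)]
    & [forall x, ~~ odd (count_mem x (map (label F) (occurrences tau t)))]].

(** Reversing one enumeration or not gives the two bijections between the endpoints of two edges. *)
Definition link (V : finType) (t : nat)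
  (z : (block t * {set V}) * (block t * {set V}) * bool) : seq (V * V) :=
  zip (enum z.1.1.2) (if z.2 then rev (enum z.1.2.2) else enum z.1.2.2).

Definition matched (V : finType) (t : nat)
  (p : seq ((block t * {set V}) * (block t * {set V}) * bool))
  (x y : block t * V) : bool :=
  has (fun z => [&& x.1 == z.1.1.1, y.1 == z.1.2.1 & (x.2, y.2) \in link z]) p.

Lemma mem_zip_l (S T : eqType) (s : seq S) (u : seq T) x :
  size s = size u -> x \in s -> exists y, (x, y) \in zip s u.
Proof.
move=> E; rewrite -{1}(@unzip1_zip _ _ s u) ?E // => /mapP[[a b] ab ->].
by exists b.
Qed.

Lemma mem_zip_r (S T : eqType) (s : seq S) (u : seq T) y :
  size s = size u -> y \in u -> exists x, (x, y) \in zip s u.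
Proof.
move=> E; rewrite -{1}(@unzip2_zip _ _ s u) ?E // => /mapP[[a b] ab ->].
by exists a.
Qed.

Lemma edge_enum (tau : gshape) (e : {set 'I_(nv tau)}) :
  e \in edges tau -> exists x y, enum e = [:: x; y].
Proof.
move/edges2; rewrite cardE; case: (enum e) => [|x [|y []]] // _.
by exists x, y.
Qed.

Lemma mem_occurrences (tau : gshape) (t : nat) o :
  (o \in occurrences tau t) = (o.2 \in edges tau).
Proof.
apply/allpairsP/idP => [[[b e] /= [_ He ->]] /=|He]; first by move: He; rewrite mem_enum.
by exists o; rewrite !mem_enum He; case: o {He}.
Qed.

Lemma uniq_occurrences (tau : gshape) (t : nat) : uniq (occurrences tau t).
Proof. by apply: allpairs_uniq; rewrite ?enum_uniq // => -[? ?] [? ?]. Qed.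

Lemma size_occurrences (tau : gshape) (t : nat) :
  size (occurrences tau t) = (t * #|edges tau|).*2.
Proof. by rewrite size_allpairs -!cardE card_prod card_ord card_bool; lia. Qed.

Lemma brank_inj t : injective (@brank t).
Proof.
move=> [k b] [k' b']; rewrite /brank /= => E.
have [Ek Eb] : k = k' :> nat /\ b = b' by move: E; case: b; case: b' => /=; lia.
by rewrite Eb (val_inj Ek).
Qed.

(** Within one block injectivity turns equal labels into equal edges, so distinct occurrences with
    one label lie in different blocks. Equality of two 2-sets leaves two ways to identify endpoints,
    recorded by the bit. *)
Lemma orient_match (tau : gshape) (t n : nat)
  (F : {ffun block t * 'I_(nv tau) -> 'I_n}) o o' :
  closed_walk F -> o.2 \in edges tau -> o'.2 \in edges tau -> o != o' ->
  label F o = label F o' ->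
  exists b, (o.1 != o'.1) &&
    all (fun xy => F (o.1, xy.1) == F (o'.1, xy.2)) (link (o, o', b)).
Proof.
case: o => b e; case: o' => b' e' /= /and3P[/forallP inj _ _] He He' no E.
have injF c : injective (fun v => F (c, v)).
  by have /injectiveP H := inj c => x y Exy; apply: H; rewrite !ffunE.
have nb : b != b'.
  apply: contraNneq no => Eb; rewrite -Eb in E *.
  by have Ee : e = e' := imset_inj (@injF b) E; rewrite Ee.
have [x1 [x2 Ex]] := edge_enum He; have [y1 [y2 Ey]] := edge_enum He'.
have Se : e = [set x1; x2] by apply/setP => v; rewrite -mem_enum Ex !inE.
have Se' : e' = [set y1; y2] by apply/setP => v; rewrite -mem_enum Ey !inE.
have nx : x1 != x2 by have := enum_uniq e; rewrite Ex /= inE andbT.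
have nF : F (b, x1) != F (b, x2) by apply: contraNneq nx => /injF ->.
have {}E : [set F (b, x1); F (b, x2)] = [set F (b', y1); F (b', y2)].
  by move: E; rewrite /label /= Se Se' !imsetU1 !imset_set1.
have := set21 (F (b, x1)) (F (b, x2)); have := set22 (F (b, x1)) (F (b, x2)).
rewrite {}E !inE /link /= Ex Ey nb /=.
move=> /orP[]/eqP E2 /orP[]/eqP E1; try by rewrite E1 E2 eqxx in nF.
- by exists true; rewrite /rev /= E1 E2 !eqxx.
- by exists false; rewrite /= E1 E2 !eqxx.
Qed.

(** * Counting closed walks *)

Lemma card_matched_walks (tau : gshape) (t n : nat) p :
  0 < t -> 0 < nv tau -> p \in pairings (t * #|edges tau|) (occurrences tau t) ->
  all (fun z => z.1.1.1 != z.1.2.1) p ->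
  all (fun z => (z.1.1.2 \in edges tau) && (z.1.2.2 \in edges tau)) p ->
  #|[set F : {ffun block t * 'I_(nv tau) -> 'I_n} |
      [forall x, forall y, (glued x y || matched p x y) ==> (F x == F y)]]|
  <= n ^ (nv tau) * n ^ (t * (nv tau - min_sep_size tau + num_isolated tau)).
Proof.
move=> t0 nv0 Hp nb Hedges.
(* Comparing exponents needs a positive base; for [n = 0] there are no functions at all, the domain
   being nonempty. *)
case: (posnP n) => [n0|n0].
  rewrite eq_card0 // => F; have := ltn_ord (F ((Ordinal t0, true), Ordinal nv0)).
  by rewrite [X in _ < X]n0.
pose R x y := glued x y || matched p x y.
pose e x y := R x y || R y x.
have e_sym : connect_sym e by apply: sym_connect_sym => x y; rewrite /e orbC.
apply: (@leq_trans (n ^ #|fingraph.root e @: setT|)).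
  rewrite -[n in n ^ _]card_ord; apply: leq_trans (card_constant_on_classes _ e_sym).
  apply/subset_leq_card/subsetP => F; rewrite !inE => /forallP H.
  apply/forallP => x; apply/forallP => y; apply/implyP => /orP[] r.
    by have /forallP/(_ y) := H x; rewrite -/(R x y) r.
  by have /forallP/(_ x) := H y; rewrite -/(R y x) r /= eq_sym.
rewrite -expnD leq_pexp2l //.
pose c := fingraph.root e.
have cR x y : R x y -> c x = c y.
  by move=> r; apply/eqP; rewrite root_connect // connect1 // /e r.
have cG x y : glued x y -> c x = c y by move=> g; apply: cR; rewrite /R g.
have cM x y : matched p x y -> c x = c y by move=> g; apply: cR; rewrite /R g orbT.
have cV k (b b' : bool) v : v \in Vs tau -> c ((k, b), v) = c ((k, b'), v).
  by move=> vV; apply: cG; rewrite /glued /= !eqxx vV.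
have cU k v : v \in Us tau -> c ((k, true), v) = c ((ordS k, false), v).
  by move=> vU; apply: cG; rewrite /glued /= !eqxx vU orbT.
(* There are [2t] blocks, so halving leaves one separator size, and bounding it by [nv tau] gives
   the factor [n ^ nv tau]. *)
suff H : (#|c @: setT|).*2 <= #|{: block t}| * (nv tau - min_sep_size tau + num_isolated tau)
                       + (min_sep_size tau).*2.
  rewrite -leq_double; apply: (leq_trans H).
  rewrite card_prod card_ord card_bool mulnAC muln2 -doubleD leq_double addnC.
  by rewrite leq_add2r min_sep_size_nv.
have t1 : t.-1 < t by case: (t) t0.
(* These two blocks are glued to each other by the cyclic closure; each has both its neighbours on
   the same side. *)
apply: (@card_classes tau _ _ (@brank t) t.*2 c (Ordinal t0, false) (Ordinal t1, true)).
- exact: brank_inj.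
- by case=> k b; rewrite /brank /=; have := ltn_ord k; case: b => /=; lia.
- move=> b a aE.
  have [|z zp] := pairings_cover (size_occurrences tau t) Hp (o := (b, a)).
    by rewrite mem_occurrences.
  have zb := allP nb z zp; have /andP[z1 z2] := allP Hedges z zp.
  have sz : size (enum z.1.1.2) = size (if z.2 then rev (enum z.1.2.2) else enum z.1.2.2).
    have [x1 [x2 ->]] := edge_enum z1; have [y1 [y2 ->]] := edge_enum z2.
    by case: ifP.
  case=> E.
    exists z.1.2.1; first by rewrite eq_sym; move: zb; rewrite -E.
    move=> x xa; have [|y xy] := mem_zip_l sz (x := x); first by rewrite mem_enum -E.
    by exists y; apply: cM; apply/hasP; exists z => //=; rewrite -E !eqxx.
  exists z.1.1.1; first by move: zb; rewrite -E.
  move=> x xa; have [|y xy] := mem_zip_r sz (y := x).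
    by case: ifP; rewrite ?mem_rev mem_enum -E.
  by exists y; apply: esym; apply: cM; apply/hasP; exists z => //=; rewrite -E !eqxx.
- move=> [k b] x /orP[xU|xV]; last first.
    by exists (k, ~~ b); [rewrite xpair_eqE eqxx; case: b|exists x; apply: cV].
  case: b.
    by exists (ordS k, false); [rewrite xpair_eqE andbF|exists x; apply: cU].
  exists (ord_pred k, true); first by rewrite xpair_eqE andbF.
  by exists x; rewrite cU // ord_predK.
- move=> [k [|]] b0 b1.
    have kt : k.+1 < t.
      move: b1; rewrite xpair_eqE eqxx andbT -val_eqE /=; have := ltn_ord k; lia.
    exists (k, false), (ordS k, false); split.
      by rewrite /brank /= modn_small //; lia.
    by right; split=> x Hx; [apply: cU|apply: cV].
  have kt : 0 < k.
    by move: b0; rewrite xpair_eqE eqxx andbT -val_eqE /= lt0n.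
  exists (ord_pred k, true), (k, true); split.
    (* [ord_pred k] has value [(k + t).-1] modulo [t], which is [k.-1] since [k] is positive. *)
    rewrite /brank /=; have kk := ltn_ord k; have -> : (k + t).-1 = k.-1 + t by lia.
    by rewrite modnDr modn_small; lia.
  by left; split=> x Hx; [rewrite cU // ord_predK|apply: cV].
Qed.

(** A union bound over matchings: every closed walk is compatible with at least one of them. *)
Lemma card_closed_walks (tau : gshape) (t n : nat) :
  0 < t -> 0 < #|edges tau| ->
  #|[set F : {ffun block t * 'I_(nv tau) -> 'I_n} | closed_walk F]| <=
  (4 * (t * #|edges tau|)) ^ (t * #|edges tau|) *
  (n ^ (nv tau) * n ^ (t * (nv tau - min_sep_size tau + num_isolated tau))).
Proof.
move=> t0 E0; set K := n ^ _ * _; set k := t * _.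
have nv0 : 0 < nv tau.
  by have /card_gt0P[e /edges2] := E0; case: (nv tau) e => // e; rewrite eq_card0 // => -[].
pose good (z : (block t * {set 'I_(nv tau)}) * (block t * {set 'I_(nv tau)}) * bool) :=
  [&& z.1.1.1 != z.1.2.1, z.1.1.2 \in edges tau & z.1.2.2 \in edges tau].
(* Requiring [all good p] makes [X p] empty for matchings that pair occurrences within one block. *)
pose X p := [set F : {ffun block t * 'I_(nv tau) -> 'I_n} | all good p &&
      [forall x, forall y, (glued x y || matched p x y) ==> (F x == F y)]].
pose L := occurrences tau t.
have HX F : closed_walk F -> exists2 p, p \in pairings k L & F \in X p.
  move=> HF; pose ok z := good z &&
    all (fun xy => F (z.1.1.1, xy.1) == F (z.1.2.1, xy.2)) (link z).
  have [|||o o' oL o'L no Eo|p Hp /allP ap] := @pairing_exists _ _ (label F) ok k L.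
  - exact: uniq_occurrences.
  - exact: size_occurrences.
  - by move=> x; have /and3P[_ _ /forallP] := HF.
  - move: oL o'L; rewrite !mem_occurrences => oL o'L.
    have [b /andP[nb Hb]] := orient_match HF oL o'L no Eo.
    by exists b; rewrite /ok /good /= nb oL o'L.
  exists p => //; rewrite inE; apply/andP; split.
    by apply/allP => z /ap/andP[].
  apply/forallP => x; apply/forallP => y; apply/implyP => /orP[g|/hasP[z zp]].
    by have /and3P[_ /forallP/(_ x)/forallP/(_ y)] := HF; rewrite g.
  case/and3P => /eqP Ex /eqP Ey xy; have /andP[_ /allP/(_ _ xy)] := ap z zp.
  by rewrite /= -Ex -Ey -!surjective_pairing.
have XK p : p \in pairings k L -> #|X p| <= K.
  move=> Hp; case: (boolP (all good p)) => [/allP ap|/negPf np]; last first.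
    by rewrite eq_card0 // => F; rewrite inE np.
  apply: leq_trans (card_matched_walks n t0 nv0 Hp _ _).
  - by apply/subset_leq_card/subsetP => F; rewrite !inE => /andP[].
  - by apply/allP => z /ap/and3P[].
  - by apply/allP => z /ap/and3P[_ -> ->].
have sK : size (pairings k L) <= (4 * k) ^ k.
  have -> : 4 * k = 2 * size L by rewrite size_occurrences -/k; lia.
  by apply: size_pairings => //; rewrite size_occurrences double_gt0 muln_gt0 t0.
apply: leq_trans (leq_mul sK (leqnn K)).
apply: (@leq_trans (\sum_(p <- pairings k L) #|X p|)); last first.
  have -> : size (pairings k L) * K = \sum_(p <- pairings k L) K.
    by rewrite big_const_seq iter_addn_0 count_predT mulnC.
  by rewrite big_seq [leqRHS]big_seq; apply: leq_sum.
(* Exchanging the sums counts each walk once per compatible matching, hence at least once if it is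
   closed. *)
rewrite -sum1_card (eq_bigr (fun p => \sum_(F in X p) 1)) => [|p _]; last by rewrite sum1_card.
rewrite (exchange_big_dep predT) //= [leqRHS](bigID (mem [set F | closed_walk F])) /=.
apply: leq_trans (leq_addr _ _); apply: leq_sum => F; rewrite inE => /HX[p Hp FX].
by rewrite sum1_count -has_count; apply/hasP; exists p.
Qed.

Local Open Scope ring_scope.

(** * Expectations of monomials *)

Lemma Exp_sum (R : realType) (n : nat) (I : finType) (P : pred I)
  (f : I -> sample n -> R) :
  Exp (fun G => \sum_(i | P i) f i G) = \sum_(i | P i) Exp (f i).
Proof. by rewrite /Exp exchange_big mulr_sumr. Qed.

Lemma eq_Exp (R : realType) (n : nat) (f g : sample n -> R) :
  f =1 g -> Exp f = Exp g.
Proof. by move=> fg; rewrite /Exp (eq_bigr g). Qed.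

Lemma card_sample_gt0 (n : nat) : (0 < #|{: sample n}|)%N.
Proof. by apply/card_gt0P; exists [ffun=> true]. Qed.

Lemma Exp_cst (R : realType) (n : nat) (c : R) : Exp (fun _ : sample n => c) = c.
Proof.
rewrite /Exp sumr_const -[c *+ _]mulr_natl mulrA mulVf ?mul1r // pnatr_eq0 -lt0n.
exact: card_sample_gt0.
Qed.

Lemma le_Exp (R : realType) (n : nat) (f g : sample n -> R) :
  (forall G, f G <= g G) -> Exp f <= Exp g.
Proof. by move=> fg; rewrite ler_wpM2l ?invr_ge0 ?ler0n // ler_sum. Qed.

Lemma Gval_le1 (R : realType) (n : nat) (G : sample n) x : `|Gval R G x| <= 1.
Proof.
rewrite /Gval; case: insub => [p|]; rewrite ?normr1 // /sgn.
by case: (G p); rewrite ?normrN1 ?normr1.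
Qed.

Lemma Exp_monomial_le1 (R : realType) (n : nat) (l : seq {set 'I_n}) :
  Exp (fun G => \prod_(x <- l) Gval R G x) <= 1.
Proof.
rewrite -[leRHS](Exp_cst n); apply: le_Exp => G.
apply: le_trans (ler_norm _) _; elim: l => [|x l IH]; first by rewrite big_nil normr1.
by rewrite big_cons normrM mulr_ile1 ?Gval_le1.
Qed.

(* Flipping the sign of [G] at the pair [x] negates the monomial. *)
Lemma Exp_monomial_odd (R : realType) (n : nat) (l : seq {set 'I_n})
  (x : {set 'I_n}) :
  #|x| == 2%N -> odd (count_mem x l) ->
  Exp (fun G => \prod_(y <- l) Gval R G y) = 0.
Proof.
move=> x2 odx.
pose fl (G : sample n) : sample n := [ffun p => if val p == x then ~~ G p else G p].
have flK : involutive fl.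
  by move=> G; apply/ffunP => p; rewrite !ffunE; case: eqP; rewrite ?negbK.
have V G y : Gval R (fl G) y = (-1) ^+ (y == x) * Gval R G y.
  rewrite /Gval; case: insubP => [p _ <-|/negPf ny]; last first.
    by case: (y =P x) ny => [->|_ _]; [rewrite x2|rewrite mul1r].
  rewrite ffunE /sgn; case: eqP => _; rewrite ?expr0 ?mul1r ?expr1 //.
  by case: (G p); rewrite ?mulN1r ?opprK.
have S : \sum_(G : sample n) \prod_(y <- l) Gval R G y
       = - \sum_(G : sample n) \prod_(y <- l) Gval R G y.
  rewrite {1}(reindex_inj (inv_inj flK)) /= -sumrN; apply: eq_bigr => G _.
  rewrite (eq_bigr _ (fun y _ => V G y)) big_split /= -[RHS]mulN1r; congr (_ * _).
  have -> : \prod_(y <- l) (-1) ^+ (y == x) = (-1) ^+ count_mem x l :> R.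
    by elim: (l) => [|y l' IHl]; rewrite ?big_nil // big_cons IHl exprD.
  by rewrite -signr_odd odx expr1.
rewrite /Exp; suff -> : \sum_(G : sample n) \prod_(y <- l) Gval R G y = 0 by rewrite mulr0.
lra.
Qed.

(** * Expanding the trace into chains *)

Lemma seqof_inj (n : nat) : injective (@seqof n).
Proof.
move=> [[k t] /= u] [[k' t'] /= u']; rewrite /seqof /= => E.
have Ek : k = k' by apply: val_inj; rewrite /= -(size_tuple t) -(size_tuple t') E.
by subst k'; apply: val_inj; congr existT; apply: val_inj.
Qed.

(** Collapses a sum over matrix indices: a duplicate-free list has length at most [n], so it is
    exactly one index. *)
Lemma sum_seqof (R : nmodType) (n : nat) (l : seq 'I_n) (x : R) :
  uniq l -> \sum_(J : dtuple n | l == seqof J) x = x.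
Proof.
move=> ul; have sl : (size l < n.+1)%N.
  by rewrite ltnS -[leqRHS]card_ord -(card_uniqP ul) max_card.
pose J0 : dtuple n := exist (fun x : {k : 'I_n.+1 & k.-tuple 'I_n} => uniq (tagged x))
   (existT (fun k : 'I_n.+1 => k.-tuple 'I_n) (Ordinal sl) (in_tuple l)) ul.
rewrite (big_pred1 J0) // => J.
by apply/eqP/eqP => [E|->] //; apply: seqof_inj.
Qed.

Lemma sum_enum_val (R : nmodType) (T : finType) (f : T -> R) :
  \sum_(i < #|T|) f (enum_val i) = \sum_x f x.
Proof. by rewrite [RHS](reindex (@enum_val T T)) //; apply/onW_bij/enum_val_bij. Qed.

Notation stepT tau n := ({ffun 'I_(nv tau) -> 'I_n} * {ffun 'I_(nv tau) -> 'I_n})%type.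

(** One factor of the Gram matrix: two realizations sharing the image of [Vs]. Consecutive steps
    share the image of [Us], as [chain] records. *)
Definition step (tau : gshape) (n : nat) (q : stepT tau n) : bool :=
  [&& injectiveb q.1, injectiveb q.2 & map q.1 (Vs tau) == map q.2 (Vs tau)].

Definition weight (R : pzRingType) (tau : gshape) (n : nat) (G : sample n)
  (q : stepT tau n) : R :=
  (\prod_(e in edges tau) Gval R G (q.1 @: e)) *
  (\prod_(e in edges tau) Gval R G (q.2 @: e)).

Fixpoint chain (tau : gshape) (n : nat) (I : seq 'I_n) (s : seq (stepT tau n))
  (J : seq 'I_n) : bool :=
  if s is q :: s' then
    [&& step q, map q.1 (Us tau) == I & chain (map q.2 (Us tau)) s' J]
  else I == J.

Lemma graph_gram_entry (R : realType) (n : nat) (tau : gshape) (G : sample n) i j :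
  let A := mx_of (graph_mx_entry R tau G) in
  (A *m A^T) i j =
  \sum_(q : stepT tau n | [&& step q, map q.1 (Us tau) == seqof (enum_val i)
                           & map q.2 (Us tau) == seqof (enum_val j)]) weight R G q.
Proof.
move=> /=; rewrite mxE; set I := enum_val i; set I' := enum_val j.
transitivity (\sum_(J : dtuple n) graph_mx_entry R tau G I J * graph_mx_entry R tau G I' J).
  rewrite -[RHS]sum_enum_val.
  by apply: eq_bigr => k _; rewrite !mxE.
rewrite /graph_mx_entry.
under [LHS]eq_bigr => J _ do rewrite big_distrlr pair_big /=.
rewrite (exchange_big_dep (fun q : stepT tau n => [&& step q, map q.1 (Us tau) == seqof I
                           & map q.2 (Us tau) == seqof I'])) /=; last first.
  move=> J q _ /andP[/and3P[i1 -> /eqP E1] /and3P[i2 -> /eqP E2]].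
  by rewrite /step i1 i2 E1 E2 eqxx.
apply: eq_bigr => q /and3P[/and3P[i1 i2 /eqP EV] U1 U2].
rewrite (eq_bigl (fun J => map q.1 (Vs tau) == seqof J)); last first.
  by move=> J; rewrite i1 i2 U1 U2 -EV /= andbb.
rewrite sum_seqof // map_inj_uniq ?Vs_uniq //; exact/injectiveP.
Qed.

Lemma big_tuple_cons (R : nmodType) (T : finType) (t : nat) (P : pred (seq T))
  (f : seq T -> R) :
  \sum_(s : t.+1.-tuple T | P s) f s =
  \sum_(z : T * t.-tuple T | P (z.1 :: z.2)) f (z.1 :: z.2).
Proof.
pose h (z : T * t.-tuple T) : t.+1.-tuple T := [tuple of z.1 :: z.2].
rewrite (reindex h) //.
exists (fun s => (thead s, [tuple of behead s])) => [[x s]|s] _ /=.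
  by congr (_, _); apply: val_inj.
by rewrite /h /= -tuple_eta.
Qed.

(** By induction on [t]; the intermediate index is forced to be the image of [Us] under the second
    realization of the first step. *)
Lemma gram_power_entry (R : realType) (n : nat) (tau : gshape) (G : sample n) t i j :
  let A := mx_of (graph_mx_entry R tau G) in
  (iter t (mulmx (A *m A^T)) 1%:M) i j =
  \sum_(s : t.-tuple (stepT tau n) |
     chain (seqof (enum_val i)) s (seqof (enum_val j)))
     \prod_(q <- s) weight R G q.
Proof.
move=> A; elim: t i => [|t IH] i.
  rewrite /= mxE big_mkcond (big_pred1 [tuple]) => [|s]; last by apply/esym/eqP/tuple0.
  by rewrite big_nil /= (inj_eq (@seqof_inj n)) (inj_eq enum_val_inj); case: eqP.
rewrite iterS mxE.
under [LHS]eq_bigr => k _ do rewrite IH graph_gram_entry big_distrlr pair_big /=.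
set I := seqof (enum_val i); set J := seqof (enum_val j).
rewrite (@big_tuple_cons _ _ t (fun s => chain I s J) (fun s => \prod_(q <- s) weight R G q)).
rewrite (sum_enum_val (fun K : dtuple n =>
   \sum_(z : stepT tau n * t.-tuple (stepT tau n) |
     [&& step z.1, map z.1.1 (Us tau) == I & map z.1.2 (Us tau) == seqof K] &&
     chain (seqof K) z.2 J) weight R G z.1 * \prod_(q <- z.2) weight R G q)) /=.
rewrite (exchange_big_dep (fun z : stepT tau n * t.-tuple (stepT tau n) =>
   chain I (z.1 :: z.2) J)) /=; last first.
  by move=> K z _ /andP[/and3P[-> -> /eqP ->]].
apply: eq_bigr => z /and3P[sz Uz cz].
rewrite (eq_bigl (fun K => map z.1.2 (Us tau) == seqof K)); last first.
  by move=> K; rewrite sz Uz /=; case: eqP => //= <-.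
rewrite sum_seqof ?big_cons // map_inj_uniq ?Us_uniq //.
by apply/injectiveP; case/and3P: sz.
Qed.

Lemma schatten_graph_mx (R : realType) (n : nat) (tau : gshape) (G : sample n) t :
  schatten_pow (mx_of (graph_mx_entry R tau G)) t =
  \sum_(I : dtuple n) \sum_(s : t.-tuple (stepT tau n) |
     chain (seqof I) s (seqof I)) \prod_(q <- s) weight R G q.
Proof.
rewrite -[RHS]sum_enum_val; apply: eq_bigr => i _.
by rewrite gram_power_entry.
Qed.

(** * From chains to closed walks *)

Lemma chain_step (tau : gshape) n I (s : seq (stepT tau n)) J :
  chain I s J -> all (@step tau n) s.
Proof. by elim: s I => //= q s IH I /and3P[-> _ /IH]. Qed.

Lemma chain_next (tau : gshape) n I (s : seq (stepT tau n)) J q0 k :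
  chain I s J -> (k < size s)%N ->
  map (nth q0 s k).2 (Us tau) =
  if (k.+1 < size s)%N then map (nth q0 s k.+1).1 (Us tau) else J.
Proof.
elim: s I k => //= q s IH I [|k] /and3P[_ _ c] ks; last exact: IH c ks.
by case: s c {IH ks} => [/eqP //|q' s] /= /and3P[_ /eqP ->].
Qed.

Definition walk_map (tau : gshape) (n t : nat) (s : t.-tuple (stepT tau n)) :
  {ffun block t * 'I_(nv tau) -> 'I_n} :=
  [ffun x => if x.1.2 then (tnth s x.1.1).2 x.2 else (tnth s x.1.1).1 x.2].

Lemma walk_map_inj (tau : gshape) (n t : nat) : injective (@walk_map tau n t).
Proof.
move=> s s' E; apply: eq_from_tnth => k.
have H (b : bool) v : walk_map s ((k, b), v) = walk_map s' ((k, b), v) by rewrite E.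
rewrite [LHS]surjective_pairing [RHS]surjective_pairing; congr (_, _).
  by apply/ffunP => v; have := H false v; rewrite !ffunE.
by apply/ffunP => v; have := H true v; rewrite !ffunE.
Qed.

(** Writes the weight as one monomial in the edge labels, so that its expectation is governed by
    their multiplicities. *)
Lemma prod_weight (R : realType) (n : nat) (tau : gshape) (G : sample n) t
  (s : t.-tuple (stepT tau n)) :
  \prod_(q <- s) weight R G q =
  \prod_(x <- map (label (walk_map s)) (occurrences tau t)) Gval R G x.
Proof.
pose W k b := \prod_(e <- enum (edges tau)) Gval R G (label (walk_map s) ((k, b), e)).
rewrite big_map big_allpairs big_enum /= (eq_bigr (fun b => W b.1 b.2)); last by case.
rewrite -(pair_big xpredT xpredT W) /= {}/W.
rewrite big_tuple; apply: eq_bigr => k _; rewrite big_bool /= mulrC /weight.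
by congr (_ * _); rewrite big_enum /=; apply: eq_bigr => e _; congr Gval;
  apply: eq_imset => v; rewrite !ffunE.
Qed.

Lemma chain_walk (tau : gshape) (n t : nat) I (s : t.-tuple (stepT tau n)) :
  chain I s I ->
  [forall b, injectiveb [ffun v => walk_map s (b, v)]] /\
  [forall x, forall y, glued x y ==> (walk_map s x == walk_map s y)].
Proof.
move=> c; have /all_tnthP st := chain_step c; split.
  apply/forallP => -[k b]; apply/injectiveP => x y; rewrite !ffunE /=.
  have /and3P[/injectiveP i1 /injectiveP i2 _] := st k.
  by case: b; [apply: i2|apply: i1].
apply/forallP => -[[k b] v]; apply/forallP => -[[k' b'] w]; apply/implyP.
case/andP => /= /eqP <- /orP[/andP[/eqP <- vV]|/and4P[]].
  rewrite !ffunE /=; have /and3P[_ _ /eqP/eq_in_map/(_ v vV)] := st k.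
  by case: b; case: b' => // ->.
case: b => // _; case: b' => // _ /eqP -> vU; rewrite !ffunE /=; apply/eqP.
have t0 : (0 < t)%N by apply: leq_ltn_trans (ltn_ord k).
have q0 := tnth s k; rewrite !(tnth_nth q0) /=.
move: v vU; apply/eq_in_map; rewrite (chain_next q0 c) ?size_tuple //.
(* At the last index [ordS] wraps to 0, and the chain ends at the tuple [I] where it began. *)
have := ltn_ord k; rewrite leq_eqVlt => /orP[/eqP ->|lt]; last by rewrite lt modn_small.
rewrite ltnn modnn; move: c t0; case: s {st} => -[|q s] /= /eqP <- //.
by case/and3P => _ /eqP ->.
Qed.

(** Terms with a label of odd multiplicity vanish and the others are at most 1. Since [t > 0], the
    index [I] is recovered from the first realization, so distinct surviving terms give distinct
    walks. *)
Lemma Exp_schatten_le (R : realType) (n : nat) (tau : gshape) (t : nat) :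
  (0 < t)%N ->
  Exp (fun G : sample n => schatten_pow (mx_of (graph_mx_entry R tau G)) t) <=
  #|[set F : {ffun block t * 'I_(nv tau) -> 'I_n} | closed_walk F]|%:R.
Proof.
move=> t0; set X := [set F | _].
rewrite (eq_Exp (schatten_graph_mx R tau ^~ t)) Exp_sum.
rewrite (eq_bigr _ (fun I _ => Exp_sum _ _)) pair_big_dep /=.
pose Y := [set z : dtuple n * t.-tuple (stepT tau n) |
  chain (seqof z.1) z.2 (seqof z.1) && closed_walk (walk_map z.2)].
apply: (@le_trans _ _ #|Y|%:R); last first.
  rewrite ler_nat -(@card_in_imset _ _ (fun z => walk_map z.2) Y).
    by apply/subset_leq_card/subsetP => _ /imsetP[z + ->]; rewrite !inE => /andP[].
  move=> [I s] [I' s']; rewrite !inE /= => /andP[c _] /andP[c' _] /walk_map_inj E.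
  subst s'; congr (_, _); apply: seqof_inj.
  by move: c c' t0; case: s => -[|q s] /= /eqP <- // /and3P[_ /eqP <- _] /and3P[_ /eqP <- _].
rewrite -sum1_card natr_sum big_mkcond [leRHS]big_mkcond /=.
apply: ler_sum => -[I s] _; rewrite inE /=; case: ifP => //= c.
rewrite (eq_Exp (fun G => prod_weight R G s)).
case: ifPn => [_|]; first exact: Exp_monomial_le1.
have [H1 H2] := chain_walk c; rewrite /closed_walk H1 H2 /= => /forallPn[x].
rewrite negbK => odx; rewrite (Exp_monomial_odd R _ odx) //.
have : x \in map (label (walk_map s)) (occurrences tau t).
  by rewrite -has_pred1 has_count; case: count odx.
case/mapP => -[b e]; rewrite mem_occurrences /= => eE ->.
rewrite card_imset /=; first exact: edges2.
by move=> v w E; have /forallP/(_ b)/injectiveP := H1; apply; rewrite !ffunE in E *.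
Qed.

(** * Centering and the final bound *)

(** An injective realization sends distinct edges to distinct pairs, so each variable of the
    monomial occurs exactly once. *)
Lemma Exp_graph_mx_entry (R : realType) (n : nat) (tau : gshape) I J :
  (0 < #|edges tau|)%N ->
  Exp (fun G : sample n => graph_mx_entry R tau G I J) = 0.
Proof.
move=> /card_gt0P[e0 e0E]; rewrite Exp_sum big1 // => phi /andP[/injectiveP inj _].
pose l := map (fun e : {set _} => phi @: e) (enum (edges tau)).
rewrite (eq_Exp (g := fun G => \prod_(x <- l) Gval R G x)); last first.
  by move=> G; rewrite big_map big_enum.
rewrite (@Exp_monomial_odd R n _ (phi @: e0)) //.
  by rewrite card_imset // edges2.
rewrite count_uniq_mem ?map_f ?mem_enum //.
by rewrite map_inj_uniq ?enum_uniq //; apply: imset_inj.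
Qed.

Theorem mainTheorem4 (R : realType) :
  exists C : R, 0 < C /\
  forall (n : nat) (tau : gshape) (t : nat), (1 <= t)%N ->
    let E := #|edges tau| in
    let EM := fun I J : dtuple n =>
      Exp (fun G : sample n => graph_mx_entry R tau G I J) in
    Exp (fun G : sample n =>
      schatten_pow (mx_of (fun I J : dtuple n =>
        graph_mx_entry R tau G I J - EM I J)) t)
    <= (C ^+ (t * E) * (n%:R) ^+ (nv tau) * (t%:R) ^+ (t * E)
          * (E%:R) ^+ (2 * t * E))
       * (n%:R) ^+ (t * (nv tau - min_sep_size tau + num_isolated tau)).
Proof.
(* The constant is the 4 of the matching count [(4tE)^(tE)]. *)
exists 4; split => // n tau t t1; cbv zeta.
set E := #|edges tau|; set EM := fun I J => Exp _.
(* Without edges the matrix is deterministic and its centered version is 0, so its trace power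
   vanishes as [t >= 1]. *)
have [E0|Epos] := posnP E.
  have E_ I J G : graph_mx_entry R tau G I J = EM I J.
    rewrite -[LHS](Exp_cst n); apply: eq_Exp => G'.
    apply: eq_bigr => phi _; rewrite !big_pred0 // => e;
      by apply: card0_eq E0 _.
  rewrite (eq_Exp (g := fun _ => 0)) => [|G].
    by rewrite Exp_cst !mulr_ge0 ?exprn_ge0 ?ler0n.
  have -> : mx_of (fun I J : dtuple n => graph_mx_entry R tau G I J - EM I J) = 0.
    by apply/matrixP => i j; rewrite !mxE E_ subrr.
  by rewrite /schatten_pow; case: (t) t1 => // t' _; rewrite iterS !mul0mx mxtrace0.
rewrite (eq_Exp (g := fun G => schatten_pow (mx_of (graph_mx_entry R tau G)) t)); last first.
  move=> G; congr schatten_pow; apply/matrixP => i j.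
  by rewrite !mxE /EM Exp_graph_mx_entry // subr0.
apply: le_trans (Exp_schatten_le R n tau t1) _.
rewrite -!natrX -!natrM ler_nat.
apply: leq_trans (card_closed_walks n t1 Epos) _.
rewrite -/E mulnA leq_mul2r; apply/orP; right.
rewrite !expnMn -!mulnA leq_mul // [leqRHS]mulnCA leq_mul // mulnC leq_mul //.
(* As [E] is positive, [E^(tE)] is at most [E^(2tE)]. *)
by rewrite leq_pexp2l // leq_pmull.
Qed.
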